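(* Let $m\ge2$ be an integer, $\rho\ge1$ fixed, and let $A_{\xi,\eta}=\langle\chi_\xi,\chi_\eta\rangle_a$, $\xi,\eta\in X$, be the entries of the stiffness matrix in the Lagrange basis of $V_{m,X}$, where $\rho_X\le\rho$. For $h_X$ sufficiently small, $$|A_{\xi,\eta}|\le C h_X^{-2}e^{-\frac{\nu}{h_X}\mathrm{dist}(\xi,\eta)}\quad\text{for all }\xi,\eta\in X,$$ with $C$ independent of $\xi,\eta$ and of $X$ (given $\rho$).
   Context: Geometry: $\mathrm{dist}$ is geodesic distance on $\mathbb S^2\subset\mathbb R^3$. For a finite set $X\subset\mathbb S^2$ of distinct points, $q_X=\min_{x\in X}\frac12\mathrm{dist}(x,X\setminus\{x\})$, $h_X=\max_{x\in\mathbb S^2}\mathrm{dist}(x,X)$, $\rho_X=h_X/q_X$. Lagrange basis: $\phi_m(t)=(-1)^m(1-t)^{m-1}\log(1-t)$, $\Pi_{m-1}$ is the space of spherical harmonics of degree at most $m-1$ on $\mathbb S^2$, and $V_{m,X}=\{\sum_{\xi\in X}a_\xi\phi_m((\cdot)\cdot\xi):\sum_\xi a_\xi p(\xi)=0\ \forall p\in\Pi_{m-1}\}+\Pi_{m-1}$. For $\xi\in X$, $\chi_\xi$ is the unique element of $V_{m,X}$ with $\chi_\xi(\eta)=\delta_{\xi,\eta}$ for $\eta\in X$ (well defined for $h_X$ small). The constant $\nu$: by known results (Fuselier, Hangelbroek, Narcowich, Ward, Wright; Hangelbroek, Narcowich, Ward) there are constants $h^*,\nu,C>0$ depending only on $m$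 and $\rho$ such that, if $h_X\le h^*$ and $\rho_X\le\rho$, then $|\chi_\xi(x)|\le C\exp(-\nu\,\mathrm{dist}(x,\xi)/h_X)$ and $|\chi_\xi(x)-\chi_\xi(y)|\le C\frac{\mathrm{dist}(x,y)}{q_X}\exp(-\nu\,\mathrm{dist}(x,\xi)/h_X)$; $\nu$ denotes this constant. Inner product: $\langle u,v\rangle_a=\int_{\mathbb S^2}\big(\sum_{i,j}a^{ij}\partial_iu\,\partial_jv+b\,uv\big)d\mu$, where $\mu$ is surface measure, $(a^{ij})$ is a $C^\infty$ symmetric contravariant rank 2 tensor with $c_1\sum g^{ij}v_iv_j\le\sum a^{ij}v_iv_j\le c_2\sum g^{ij}v_iv_j$ for constants $c_1,c_2>0$ ($g$ the standard metric), and $b\in C^\infty(\mathbb S^2)$ with $0<b_1\le b\le b_2$. *)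

(* Defs.v *)
From HB Require Import structures.
From mathcomp Require Import all_boot all_order all_algebra finmap.
From mathcomp Require Import all_classical all_reals all_analysis.
(* Not imported: its notations clash with those of mathcomp-analysis. *)
From mathcomp Require mpoly.

Set Implicit Arguments.
Unset Strict Implicit.
Unset Printing Implicit Defensive.

Import Order.TTheory GRing.Theory Num.Theory.
Import numFieldNormedType.Exports.

Local Open Scope classical_set_scope.
Local Open Scope ring_scope.

Section Sphere.
Context {R : realType}.

Definition dot (x y : 'rV[R]_3) : R := \sum_i x 0 i * y 0 i.

Definition sphere : Type := {x : 'rV[R]_3 | dot x x == 1}.

Definition gdist (x y : sphere) : R := acos (dot (val x) (val y)).

Definition gdist_set (x : sphere) (A : set sphere) : R := inf [set gdist x y | y in A].

(* For the finite nonempty sets considered below, the infima in [gdist_set] and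
   [sep_radius] are minima and the supremum in [mesh_norm] is a maximum.
   [sep_radius] and [mesh_ratio] are meaningful when X has at least two points. *)
Definition sep_radius (X : {fset sphere}) : R :=
  inf [set 2^-1 * gdist_set x ([set` X] `\ x) | x in [set` X]].

Definition mesh_norm (X : {fset sphere}) : R :=
  sup [set gdist_set x [set` X] | x in setT].

Definition mesh_ratio (X : {fset sphere}) : R := mesh_norm X / sep_radius X.

Definition spherical_harmonic (l : nat) (f : sphere -> R) : Prop :=
  exists p : mpoly.dhomog 3 R l,
    \sum_(i < 3) mpoly.mderiv i (mpoly.mderiv i (mpoly.mpoly_of_dhomog p)) = 0 /\
    forall x : sphere, f x = mpoly.meval (fun i => val x 0 i) (mpoly.mpoly_of_dhomog p).

(* [Pi_lt m] is the space of spherical harmonics of degree at most m - 1. *)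
Definition Pi_lt (m : nat) (f : sphere -> R) : Prop :=
  exists Y : 'I_m -> sphere -> R,
    (forall l : 'I_m, spherical_harmonic l (Y l)) /\ forall x, f x = \sum_l Y l x.

(* At t = 1 the value is 0 when m >= 2, which is the continuous extension. *)
Definition spline_kernel (m : nat) (t : R) : R :=
  (-1) ^+ m * (1 - t) ^+ m.-1 * ln (1 - t).

Definition V_space (m : nat) (X : {fset sphere}) (f : sphere -> R) : Prop :=
  exists (a p0 : sphere -> R),
    [/\ forall p, Pi_lt m p -> \sum_(xi <- X) a xi * p xi = 0,
        Pi_lt m p0 &
        forall x, f x =
          \sum_(xi <- X) a xi * spline_kernel m (dot (val x) (val xi)) + p0 x].

Definition is_lagrange (m : nat) (X : {fset sphere}) (xi : sphere) (f : sphere -> R) : Prop :=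
  unique (fun g => V_space m X g /\
                   forall eta, eta \in X -> g eta = (xi == eta)%:R) f.

Definition admissible (h rho : R) (X : {fset sphere}) : Prop :=
  [/\ (1 < #|` X|)%N, mesh_norm X <= h & mesh_ratio X <= rho].

(* The Lipschitz estimate is only required at distances up to the separation
   radius: since its right-hand side decays in dist(x, xi) alone, it cannot hold
   with y = xi and x far from xi once the mesh norm is small. *)
Definition lagrange_decay (m : nat) (rho nu : R) : Prop :=
  exists hstar C : R, [/\ 0 < hstar, 0 < C &
    forall X, admissible hstar rho X ->
    forall (xi : sphere) (chi : sphere -> R), xi \in X -> is_lagrange m X xi chi ->
      (forall x, `|chi x| <= C * expR (- nu * gdist x xi / mesh_norm X)) /\
      (forall x y, gdist x y <= sep_radius X ->
         `|chi x - chi y| <=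
           C * (gdist x y / sep_radius X) * expR (- nu * gdist x xi / mesh_norm X))].

Lemma pole_subproof : dot (delta_mx 0 0) (delta_mx 0 0) == 1.
Proof.
rewrite /dot (bigD1 0) //= big1 ?addr0 ?mxE ?eqxx ?mulr1 // => i /negPf ni.
by rewrite !mxE ni andbF mulr0.
Qed.

Definition pole : sphere := exist _ (delta_mx 0 0) pole_subproof.

(* The value at y = 0 is irrelevant. *)
Definition radial_proj (y : 'rV[R]_3) : sphere :=
  insubd pole ((Num.sqrt (dot y y))^-1 *: y).

(* Functions on the sphere are differentiated through their extensions to
   R^3 \ {0} that are constant along rays. *)
Definition ray_ext (f : sphere -> R) (y : 'rV[R]_3) : R := f (radial_proj y).

Definition unit_vec (i : 'I_3) : 'rV[R]_3 := delta_mx 0 i.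

(* The gradient for the round metric, as a vector of R^3 orthogonal to x. *)
Definition sgrad (f : sphere -> R) (x : sphere) : 'rV[R]_3 :=
  \row_i 'D_(unit_vec i) (ray_ext f) (val x).

Fixpoint Ck_on (k : nat) (U : set 'rV[R]_3) (F : 'rV[R]_3 -> R) : Prop :=
  (forall y, U y -> {for y, continuous F}) /\
  match k with
  | 0 => True
  | k'.+1 => forall i : 'I_3,
      (forall y, U y -> derivable F y (unit_vec i)) /\
      Ck_on k' U (fun y => 'D_(unit_vec i) F y)
  end.

Definition smooth_on_sphere (f : sphere -> R) : Prop :=
  forall k, Ck_on k [set y | y != 0] (ray_ext f).

(* A contravariant rank 2 tensor at x is an element of T_x (x) T_x, where
   T_x is the orthogonal complement of x in R^3; it is given by a 3 x 3 matrix
   annihilated by x on both sides.  Covectors at x are identified with tangent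
   vectors by the round metric g, so that g^{ij} v_i v_j is [dot v v]. *)
Definition elliptic_tensor (a : sphere -> 'M[R]_3) : Prop :=
  [/\ forall i j, smooth_on_sphere (fun x => a x i j),
      forall x, (a x)^T = a x,
      forall x, val x *m a x = 0 &
      exists c1 c2 : R, [/\ 0 < c1, 0 < c2 &
        forall (x : sphere) (v : 'rV[R]_3), dot v (val x) = 0 ->
          c1 * dot v v <= dot (v *m a x) v <= c2 * dot v v]].

Definition elliptic_potential (b : sphere -> R) : Prop :=
  smooth_on_sphere b /\ exists b1 b2 : R, 0 < b1 /\ forall x, b1 <= b x <= b2.

Definition sph_coord (theta phi : R) : 'rV[R]_3 :=
  \row_(i < 3) nth 0 [:: sin theta * cos phi; sin theta * sin phi; cos theta] i.

Lemma sph_coord_subproof theta phi :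
  dot (sph_coord theta phi) (sph_coord theta phi) == 1.
Proof.
rewrite /dot !big_ord_recl big_ord0 !mxE /= addr0 -!expr2 !exprMn addrA -mulrDr.
by rewrite cos2Dsin2 mulr1 addrC cos2Dsin2.
Qed.

Definition sph_param (theta phi : R) : sphere :=
  exist _ (sph_coord theta phi) (sph_coord_subproof theta phi).

(* The integral against surface measure, in spherical coordinates. *)
Definition sphere_integral (f : sphere -> R) : R :=
  \int[(lebesgue_measure \x lebesgue_measure)%E]_(z in `[0, pi] `*` `[0, 2 * pi])
    (f (sph_param z.1 z.2) * sin z.1).

Definition inner_a (a : sphere -> 'M[R]_3) (b : sphere -> R) (u v : sphere -> R) : R :=
  sphere_integral (fun x => dot (sgrad u x *m a x) (sgrad v x) + b x * u x * v x).

End Sphere.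

Arguments sphere : clear implicits.

(* Main.v *)
(* Both the values and, through the Lipschitz estimate, the gradient of chi_xi at
   x are bounded by a constant times h^-1 exp(- nu dist(x, xi) / h), since
   1 / q <= rho / h.  The integrand of <chi_xi, chi_eta>_a is therefore at most a
   constant times h^-2 exp(- nu (dist(x, xi) + dist(x, eta)) / h), and the
   triangle inequality for the geodesic distance bounds the exponential by
   exp(- nu dist(xi, eta) / h), which no longer depends on x.  Integrating over
   the sphere only costs its area.

   The integrand is not shown to be measurable, nor chi_xi to be differentiable:
   the integral of a bounded function over a set of finite measure obeys the
   usual bound in any case, and a partial derivative that does not exist is 0. *)
Require Import Defs.
From mathcomp Require Import all_boot all_order all_algebra finmap.
From mathcomp Require Import all_classical all_reals all_analysis.
From mathcomp Require Import ring lra.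
Import Order.TTheory GRing.Theory Num.Theory.
Import numFieldNormedType.Exports.
Local Open Scope classical_set_scope.
Local Open Scope ring_scope.

(** * Integral bounds and two facts on real numbers *)

(** The integral of a nonnegative function is a supremum over the simple functions below it, and a
    larger function has more of them. *)
Lemma ge0_le_integral_nomeas d (T : measurableType d) (R : realType)
    (mu : {measure set T -> \bar R}) (D : set T) (f g : T -> \bar R) :
  (forall x, D x -> (0 <= f x)%E) -> (forall x, D x -> (f x <= g x)%E) ->
  (\int[mu]_(x in D) f x <= \int[mu]_(x in D) g x)%E.
Proof.
move=> f0 fg; have g0 x : D x -> (0 <= g x)%E.
  by move=> Dx; exact: le_trans (f0 x Dx) (fg x Dx).
rewrite !ge0_integralE//; apply: le_ereal_sup => _ [h /= hf <-].
exists h => //= x; apply: le_trans (hf x) _; rewrite /patch.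
by case: ifPn => //; rewrite inE => /fg.
Qed.

(** The integrals of the positive and negative parts both lie in [[0, M * mu D]], hence so does the
    absolute value of their difference. *)
Lemma normr_Rintegral_le d (T : measurableType d) (R : realType)
    (mu : {measure set T -> \bar R}) (D : set T) (f : T -> R) (M : R) :
  measurable D -> (mu D < +oo)%E -> 0 <= M -> (forall x, D x -> `|f x| <= M) ->
  `|\int[mu]_(x in D) f x| <= M * fine (mu D).
Proof.
move=> mD muD M0 fM; rewrite /Rintegral integralE.
have muDfin : mu D \is a fin_num by rewrite ge0_fin_numE.
have cstM : (\int[mu]_(x in D) (cst M%:E) x = (M * fine (mu D))%:E)%E.
  by rewrite integral_cst// EFinM fineK.
have bnd (g : T -> \bar R) : (forall x, 0 <= g x)%E ->
    (forall x, D x -> g x <= M%:E)%E ->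
    exists2 r, (\int[mu]_(x in D) g x = r%:E)%E & 0 <= r <= M * fine (mu D).
  move=> g0 gM.
  have i0 : (0 <= \int[mu]_(x in D) g x)%E by apply: integral_ge0 => x _.
  have iM : (\int[mu]_(x in D) g x <= (M * fine (mu D))%:E)%E.
    by rewrite -cstM; apply: ge0_le_integral_nomeas => x Dx; [exact: g0|exact: gM].
  have ifin : (\int[mu]_(x in D) g x)%E \is a fin_num.
    by rewrite ge0_fin_numE// (le_lt_trans iM)// ltry.
  exists (fine (\int[mu]_(x in D) g x)); first by rewrite fineK.
  by rewrite -!lee_fin fineK// i0 iM.
have posM x : D x -> ((fun x => (f x)%:E)^\+ x <= M%:E)%E.
  move=> Dx; rewrite funeposE -EFin_max lee_fin ge_max M0 andbT.
  exact: le_trans (ler_norm _) (fM x Dx).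
have negM x : D x -> ((fun x => (f x)%:E)^\- x <= M%:E)%E.
  move=> Dx; rewrite funenegE -EFinN -EFin_max lee_fin ge_max M0 andbT.
  by apply: le_trans (fM x Dx); rewrite -normrN ler_norm.
have [p -> /andP[p0 pM]] := bnd _ (funepos_ge0 _) posM.
have [n -> /andP[n0 nM]] := bnd _ (funeneg_ge0 _) negM.
rewrite /= ler_norml; apply/andP; split; lra.
Qed.

Lemma finite_inf_gt0 (R : realType) (A : set R) :
  finite_set A -> A !=set0 -> (forall a, A a -> 0 < a) -> 0 < inf A.
Proof.
move=> /finite_seqP[s ->] ne pos.
suff [e e0 es] : exists2 e : R, 0 < e & forall a, a \in s -> e <= a.
  by apply: lt_le_trans e0 _; apply: lb_le_inf.
elim: s pos {ne} => [|a s IH] pos; first by exists 1.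
have [|e e0 es] := IH; first by move=> c cs; apply: pos; rewrite /= in_cons cs orbT.
exists (Num.min a e); first by rewrite lt_min e0 pos//= mem_head.
by move=> c; rewrite in_cons ge_min => /orP[/eqP->|/es ->]; rewrite ?lexx ?orbT.
Qed.

(** With [d = acos c] the right-hand side is [tan d], and [d <= tan d] by the mean value theorem,
    the derivative [cos^-2] being at least 1. *)
Lemma acos_le_tan (R : realType) (c : R) :
  0 < c -> c <= 1 -> acos c <= Num.sqrt (1 - c ^+ 2) / c.
Proof.
move=> c0 c1; have c11 : -1 <= c <= 1 by lra.
have /acosK cosd : c \in `[-1, 1] by rewrite in_itv/=.
have sind := sin_acos c11.
have d0 := acos_ge0 c11.
move: (acos c) cosd sind d0 (acos_lepi c11) => d cosd sind d0 dpi.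
rewrite -sind -[in X in _ / X]cosd -/(tan d).
have dpi2 : d < pi / 2.
  have pi0 := pi_gt0 R.
  rewrite -ltr_cos ?in_itv/= ?cos_pihalf ?cosd ?d0 ?dpi//; lra.
have cos_pos y : 0 <= y <= d -> 0 < cos y.
  by move=> /andP[? ?]; apply: cos_gt0_pihalf; have := pi_gt0 R; lra.
have der y : y \in `]0, d[ -> is_derive y 1 (@tan R) ((cos y) ^- 2).
  rewrite in_itv/= => /andP[? ?]; apply: is_derive_tan.
  by rewrite gt_eqF// cos_pos//; lra.
have cont : {within `[0, d], continuous (@tan R)}.
  apply: continuous_in_subspaceT => y; rewrite inE/= in_itv/= => yd.
  by apply: continuous_tan; rewrite gt_eqF// cos_pos.
have [y yd] := MVT_segment d0 der cont.
have cosy : 0 < cos y by rewrite cos_pos// -in_itv.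
by rewrite tan0 !subr0 => ->; rewrite ler_peMl// invf_ge1 ?exprn_gt0// expr_le1 ?cos_le1// ltW.
Qed.

(** * The geodesic distance as a metric *)

Section SphereGeometry.
Context {R : realType}.
Implicit Types (x y z : sphere R) (X : {fset sphere R}).

Let dotE (u v : 'rV[R]_3) :
  dot u v = u 0 0 * v 0 0 + u 0 1 * v 0 1 + u 0 (2 : 'I_3) * v 0 (2 : 'I_3).
Proof.
rewrite /dot !big_ord_recl big_ord0 addr0 addrA.
by congr (_ + _ * _ + _ * _); congr (_ _ _); apply/val_inj.
Qed.

Lemma dotC (u v : 'rV[R]_3) : dot u v = dot v u.
Proof. by rewrite /dot; apply: eq_bigr => i _; rewrite mulrC. Qed.

Lemma dotDl (u v w : 'rV[R]_3) : dot (u + v) w = dot u w + dot v w.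
Proof. by rewrite /dot -big_split; apply: eq_bigr => i _; rewrite mxE mulrDl. Qed.

Lemma dotDr (u v w : 'rV[R]_3) : dot u (v + w) = dot u v + dot u w.
Proof. by rewrite dotC dotDl !(dotC _ u). Qed.

Lemma dotZl (c : R) (u v : 'rV[R]_3) : dot (c *: u) v = c * dot u v.
Proof. by rewrite /dot mulr_sumr; apply: eq_bigr => i _; rewrite mxE mulrA. Qed.

Lemma dotZr (c : R) (u v : 'rV[R]_3) : dot u (c *: v) = c * dot u v.
Proof. by rewrite dotC dotZl dotC. Qed.

Lemma dot_mulmx (u v : 'rV[R]_3) : dot u v = (u *m v^T) 0 0.
Proof. by rewrite /dot mxE; apply: eq_bigr => i _; rewrite mxE. Qed.

Lemma dot_unit_vec (u : 'rV[R]_3) (i : 'I_3) : dot u (unit_vec i) = u 0 i.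
Proof. by rewrite dot_mulmx trmx_delta -colE mxE. Qed.

Lemma dotxx x : dot (val x) (val x) = 1.
Proof. exact/eqP/(valP x). Qed.

(** This is the squared norm of [x + e y]; its sign for [e = 1] and [e = -1] gives Cauchy-Schwarz,
    its vanishing for [e = -1] gives [x = y]. *)
Lemma sum_sqr_lin x y (e : R) :
  \sum_i (val x 0 i + e * val y 0 i) ^+ 2 =
  1 + 2 * e * dot (val x) (val y) + e ^+ 2.
Proof.
transitivity (dot (val x) (val x) + 2 * e * dot (val x) (val y) +
    e ^+ 2 * dot (val y) (val y)); last by rewrite !dotxx mulr1.
by rewrite /dot !mulr_sumr -!big_split /=; apply: eq_bigr => i _; ring.
Qed.

Lemma dot_itv x y : -1 <= dot (val x) (val y) <= 1.
Proof.
have pos (e : R) : 0 <= \sum_i (val x 0 i + e * val y 0 i) ^+ 2.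
  by apply: sumr_ge0 => i _; exact: sqr_ge0.
by have := pos 1; have := pos (-1); rewrite !sum_sqr_lin; lra.
Qed.

Lemma gdistC x y : gdist x y = gdist y x.
Proof. by rewrite /gdist dotC. Qed.

Lemma gdist_ge0 x y : 0 <= gdist x y.
Proof. exact/acos_ge0/dot_itv. Qed.

Lemma gdist_lepi x y : gdist x y <= pi.
Proof. exact/acos_lepi/dot_itv. Qed.

Lemma gdist_gt0 x y : x != y -> 0 < gdist x y.
Proof.
move=> xy; have /andP[xy1 xy2] := dot_itv x y.
apply: acos_gt0; rewrite xy1 lt_neqAle xy2 andbT /=.
apply: contra_neq xy => xy; apply/val_inj/rowP => i.
have : \sum_i (val x 0 i + -1 * val y 0 i) ^+ 2 = 0.
  by rewrite sum_sqr_lin xy; ring.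
move/psumr_eq0P => /(_ (fun j _ => sqr_ge0 _) i isT)/eqP.
by rewrite sqrf_eq0 mulN1r subr_eq0 => /eqP.
Qed.

Lemma cos_gdist x y : cos (gdist x y) = dot (val x) (val y).
Proof. by rewrite /gdist acosK// in_itv/= dot_itv. Qed.

(* With p, q, r the pairwise products, cos (a + b) <= r reduces to
   (p q - r)^2 <= (1 - p^2) (1 - q^2), that is, to the nonnegativity of the Gram
   determinant of x, y, z, which is det(x, y, z)^2. *)
Lemma gdist_triangle y x z : gdist x z <= gdist x y + gdist y z.
Proof.
(* Cosines can be compared only on [[0, pi]]; a sum of at least [pi] exceeds every distance
   anyway. *)
have [|lepi] := leP pi (gdist x y + gdist y z).
  exact: le_trans (gdist_lepi x z).
rewrite leNgt -ltr_cos ?in_itv/= ?gdist_ge0 ?gdist_lepi ?addr_ge0 ?gdist_ge0 ?(ltW lepi)//.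
rewrite -leNgt cosD !cos_gdist /gdist !sin_acos ?dot_itv// lerBlDr -lerBlDl.
set p := dot _ _; set q := dot (val y) _; set r := dot _ _.
have [p2 q2] : p ^+ 2 <= 1 /\ q ^+ 2 <= 1.
  by have := dot_itv x y; have := dot_itv y z; rewrite -/p -/q; split; nra.
rewrite -sqrtrM ?subr_ge0//.
apply: le_trans (ler_norm _) _; rewrite -sqrtr_sqr ler_wsqrtr//.
have [hx hy hz] := And3 (dotxx x) (dotxx y) (dotxx z).
pose det (u v w : 'rV[R]_3) := u 0 0 * (v 0 1 * w 0 (2 : 'I_3) - v 0 (2 : 'I_3) * w 0 1)
  - u 0 1 * (v 0 0 * w 0 (2 : 'I_3) - v 0 (2 : 'I_3) * w 0 0)
  + u 0 (2 : 'I_3) * (v 0 0 * w 0 1 - v 0 1 * w 0 0).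
rewrite -subr_ge0.
suff -> : (1 - p ^+ 2) * (1 - q ^+ 2) - (p * q - r) ^+ 2 =
    det (val x) (val y) (val z) ^+ 2 by exact: sqr_ge0.
transitivity (dot (val x) (val x) * dot (val y) (val y) * dot (val z) (val z) +
  2 * p * q * r - dot (val x) (val x) * q ^+ 2 - dot (val y) (val y) * r ^+ 2
  - dot (val z) (val z) * p ^+ 2).
  by rewrite hx hy hz; ring.
by rewrite /p /q /r /det !dotE; ring.
Qed.
End SphereGeometry.

(** * Positivity of the separation radius and of the mesh norm *)

Section PointSets.
Context {R : realType}.
Implicit Types (x y : sphere R) (X : {fset sphere R}).

Lemma gdist_set_gt0 x (A : set (sphere R)) :
  finite_set A -> A !=set0 -> ~ A x -> 0 < gdist_set x A.
Proof.
move=> finA [y Ay] nAx; apply: finite_inf_gt0.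
- exact: finite_image.
- by exists (gdist x y); exists y.
- by move=> _ [z Az <-]; apply: gdist_gt0; apply: contra_notN nAx => /eqP ->.
Qed.

Lemma gdist_set_le x y (A : set (sphere R)) : A y -> gdist_set x A <= gdist x y.
Proof.
move=> Ay; apply: ge_inf; last by exists y.
by exists 0 => _ [z _ <-]; exact: gdist_ge0.
Qed.

Lemma sep_radius_gt0 X : (1 < #|` X|)%N -> 0 < sep_radius X.
Proof.
move=> X1; apply: finite_inf_gt0.
- exact/finite_image/finite_fset.
- have /fset0Pn[x xX] : X != fset0 by rewrite -cardfs_gt0; exact: leq_trans X1.
  by exists (2^-1 * gdist_set x ([set` X] `\ x)), x.
- move=> _ [x xX <-]; rewrite mulr_gt0 ?invr_gt0//; apply: gdist_set_gt0.
  + exact/finite_setD/finite_fset.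
  + have /fset0Pn[y] : (X `\ x)%fset != fset0.
      by rewrite -cardfs_gt0; move: X1; rewrite (cardfsD1 x) (xX : x \in X).
    by rewrite in_fsetD1 => /andP[/eqP yx yX]; exists y.
  + by move=> [_ /(_ erefl)].
Qed.

(** The points of one meridian at polar angles [1 / (n + 1)] are told apart by their third
    coordinate, as cosine is injective on [[0, pi]]. *)
Lemma infinite_sphere : infinite_set [set: sphere R].
Proof.
pose f (n : nat) : sphere R := sph_param n.+1%:R^-1 0.
have f_inj : injective f.
  move=> n k /(congr1 (fun z : sphere R => val z 0 (2 : 'I_3))).
  rewrite !mxE /= => /cos_inj; rewrite !in_itv /= !invr_ge0 !ler0n /=.
  have le_pi j : j.+1%:R^-1 <= pi :> R.
    apply: (@le_trans _ _ 1); first by rewrite invf_le1 ?ler1n.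
    by have := pi_ge2 R; lra.
  by move=> /(_ (le_pi n) (le_pi k))/invr_inj/eqP; rewrite eqr_nat => /eqP[].
move=> fin; apply: infinite_nat; rewrite -(preimage_setT f).
by apply: finite_preimage => // n k _ _; exact: f_inj.
Qed.

(** A finite set misses some point of the sphere, whose distance to [X] is positive; the supremum
    dominates it because all distances are at most [pi]. *)
Lemma mesh_norm_gt0 X : X != fset0 -> 0 < mesh_norm X.
Proof.
move=> /fset0Pn[y yX].
have [x [_ nxX]] := infinite_setN0 (infinite_setD infinite_sphere (finite_fset X)).
have x_pos : 0 < gdist_set x [set` X].
  by apply: gdist_set_gt0 => //; [exact: finite_fset|exists y].
apply: lt_le_trans x_pos _; apply: ub_le_sup; last by exists x.
exists pi => _ [z _ <-].
exact: le_trans (gdist_set_le z y [set` X] yX) (gdist_lepi z y).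
Qed.

End PointSets.

(** * From a local Lipschitz bound to a gradient bound *)

Section Gradient.
Context {R : realType}.
Implicit Types x y : sphere R.

Lemma radial_proj_val x : radial_proj (val x) = x.
Proof.
by apply/val_inj; rewrite /radial_proj val_insubd dotxx sqrtr1 invr1 scale1r dotxx eqxx.
Qed.

Lemma dot_shift x (i : 'I_3) (t : R) :
  dot (t *: unit_vec i + val x) (t *: unit_vec i + val x) =
  1 + 2 * t * val x 0 i + t ^+ 2.
Proof.
rewrite !(dotDl, dotDr, dotZl, dotZr) (dotC (unit_vec i) (val x)).
by rewrite !dot_unit_vec dotxx mxE !eqxx /=; ring.
Qed.

Lemma dot_val_shift x (i : 'I_3) (t : R) :
  dot (val x) (t *: unit_vec i + val x) = 1 + t * val x 0 i.
Proof. by rewrite dotDr dotZr dot_unit_vec dotxx addrC. Qed.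

Lemma sphere_coord_sqr_le1 x (i : 'I_3) : val x 0 i ^+ 2 <= 1.
Proof.
apply: le_trans (_ : dot (val x) (val x) <= 1); last by rewrite dotxx.
rewrite /dot (bigD1 i)//= -expr2 lerDl.
by apply: sumr_ge0 => j _; rewrite -expr2 sqr_ge0.
Qed.

(** The angle between [x] and [y = x + t e_i] has tangent [|t| sqrt(1 - c^2) / (1 + t c)], with [c]
    the i-th coordinate of [x]; the denominator is at least 1/2. *)
Lemma gdist_radial_proj_le x (i : 'I_3) (t : R) : `|t| <= 2^-1 ->
  gdist x (radial_proj (t *: unit_vec i + val x)) <= 2 * `|t|.
Proof.
move=> t2; set y := _ + _; set c := val x 0 i.
have c1 : c ^+ 2 <= 1 := sphere_coord_sqr_le1 x i.
have tc : 2^-1 <= 1 + t * c.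
  have : `|t * c| <= 2^-1 * 1.
    rewrite normrM ler_pM// -(@expr_le1 _ 2)// real_normK ?num_real//.
  by rewrite ler_norml; lra.
pose N := Num.sqrt (dot y y).
have N2 : N ^+ 2 = 1 + 2 * t * c + t ^+ 2.
  by rewrite sqr_sqrtr dot_shift// -/c; nra.
have N0 : 0 < N.
  by rewrite sqrtr_gt0 dot_shift -/c; nra.
have valy : val (radial_proj y) = N^-1 *: y.
  rewrite /radial_proj val_insubd -/N.
  suff -> : dot (N^-1 *: y) (N^-1 *: y) == 1 by [].
  rewrite dotZl dotZr dot_shift -/c -N2; apply/eqP; field.
  by rewrite gt_eqF.
rewrite /gdist valy.
rewrite dotZr dot_val_shift -/c mulrC.
set d := _ / N; have d0 : 0 < d by rewrite divr_gt0//; lra.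
have d2N : d ^+ 2 * N ^+ 2 = (1 + t * c) ^+ 2.
  by rewrite /d; field; rewrite gt_eqF.
have d1 : d <= 1.
  rewrite -(@expr_le1 _ 2) ?(ltW d0)// -(@ler_pM2r _ (N ^+ 2)) ?exprn_gt0// d2N N2; nra.
apply: le_trans (acos_le_tan _ _ d0 d1) _; rewrite ler_pdivrMr//.
clearbody d; have -> : 2 * `|t| * d = Num.sqrt ((2 * t * d) ^+ 2).
  by rewrite sqrtr_sqr !normrM (@gtr0_norm _ d)// (@ger0_norm _ 2).
rewrite ler_wsqrtr// -(@ler_pM2r _ (N ^+ 2)) ?exprn_gt0//.
(* Both sides are the squared length of the part of [y] orthogonal to [x]. *)
have -> : (1 - d ^+ 2) * N ^+ 2 = t ^+ 2 * (1 - c ^+ 2) by rewrite mulrBl d2N N2; ring.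
have -> : (2 * t * d) ^+ 2 * N ^+ 2 = t ^+ 2 * (4 * (1 + t * c) ^+ 2).
  by rewrite -d2N; ring.
by rewrite ler_wpM2l ?sqr_ge0//; have := sqr_ge0 c; nra.
Qed.

(** For small [t] the difference quotient of [ray_ext f] is at most [L * (2 |t|) / |t|], where the 2
    comes from [gdist_radial_proj_le]; the bound passes to the limit. *)
Lemma normr_sgrad_le (f : sphere R -> R) x (q L : R) (i : 'I_3) :
  0 < q -> 0 <= L ->
  (forall y, gdist x y <= q -> `|f x - f y| <= L * gdist x y) ->
  `|sgrad f x 0 i| <= 2 * L.
Proof.
move=> q0 L0 lip; rewrite mxE /derive.
set F := (fun t : R => _).
(* Without a limit, the derivative takes the default value 0. *)
have [cF|/dvgP ->] := pselect (cvg (F @ 0^')); last by rewrite normr0 mulr_ge0.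
rewrite -lim_norm//; apply: limr_le; first exact: is_cvg_norm.
near=> t.
have t0 : t != 0 by near: t; exact: nbhs_dnbhs_neq.
(* The bound 1/2 allows [gdist_radial_proj_le]; [q / 2] keeps the projected point within distance
   [q] of [x]. *)
have t_small : `|t| < Num.min 2^-1 (q / 2).
  near: t; apply: dnbhs0_lt; rewrite lt_min; apply/andP; split; lra.
move: t_small; rewrite lt_min => /andP[t2 tq].
have dt := gdist_radial_proj_le x i t (ltW t2).
rewrite /F /= /shift /= normrZ normfV ler_pdivrMl ?normr_gt0//.
rewrite /ray_ext radial_proj_val distrC.
apply: le_trans (lip _ _) _; first by apply: le_trans dt _; lra.
have -> : `|t| * (2 * L) = L * (2 * `|t|) by ring.
exact: ler_wpM2l.
Unshelve. all: by end_near. Qed.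

End Gradient.

(** * Entries of the elliptic tensor *)

Section Forms.
Context {R : realType}.

(** As [a x] kills [x] on both sides, ellipticity on tangent vectors bounds the form on all of R^3.
    Polarization with [e_i], [e_j] and [e_i + e_j] then bounds the entries; [2 * c2] is a
    convenient, not a sharp, constant. *)
Lemma elliptic_entry_le (a : sphere R -> 'M[R]_3) :
  elliptic_tensor a -> exists2 c : R, 0 < c & forall x i j, `|a x i j| <= c.
Proof.
case=> _ asym akill [c1 [c2 [c10 c20 abnd]]].
exists (2 * c2); first by rewrite mulr_gt0.
move=> x i j; have killT : a x *m (val x)^T = 0.
  by apply: trmx_inj; rewrite trmx_mul trmxK asym akill trmx0.
have Q (w : 'rV[R]_3) : 0 <= dot (w *m a x) w <= c2 * dot w w.
  pose s := dot w (val x); pose p := w - s *: val x.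
  have wE : w = s *: val x + p by rewrite /p addrC subrK.
  have px : dot p (val x) = 0.
    by rewrite /p dotDl -scaleNr dotZl dotxx mulr1 subrr.
  clearbody p.
  have -> : dot (w *m a x) w = dot (p *m a x) p.
    rewrite [in LHS]wE mulmxDl -scalemxAl akill scaler0 add0r dotDr dotZr.
    suff -> : dot (p *m a x) (val x) = 0 by rewrite mulr0 add0r.
    by rewrite dot_mulmx -mulmxA killT mulmx0 mxE.
  have -> : dot w w = s ^+ 2 + dot p p.
    by rewrite [in LHS]wE !(dotDl, dotDr, dotZl, dotZr) dotxx (dotC (val x) p) px; ring.
  have /andP[lo up] := abnd x p px.
  have pp : 0 <= dot p p by rewrite /dot sumr_ge0// => k _; rewrite -expr2 sqr_ge0.
  apply/andP; split; first by apply: le_trans lo; rewrite mulr_ge0// ltW.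
  by apply: le_trans up _; rewrite ler_wpM2l ?(ltW c20)// lerDr sqr_ge0.
have entry k l : dot (unit_vec k *m a x) (unit_vec l) = a x k l.
  by rewrite dot_unit_vec -rowE mxE.
have asymE k l : a x k l = a x l k by rewrite -[in LHS](asym x) mxE.
have := Q (unit_vec i); have := Q (unit_vec j); have := Q (unit_vec i + unit_vec j).
rewrite mulmxDl !(dotDl, dotDr) !entry !dot_unit_vec !mxE !eqxx /= (asymE j i) (eq_sym j i).
rewrite ler_norml; case: (i == j) => /=; move=> /andP[? ?] /andP[? ?] /andP[? ?].
  by apply/andP; split; lra.
by apply/andP; split; lra.
Qed.

End Forms.

(** * Integration over the sphere and the final estimate *)

(** The density [sin] is at most 1 in absolute value, so the measure [2 pi^2] of the parameter
    rectangle can stand in for the area [4 pi]. *)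
Lemma normr_sphere_integral_le (R : realType) (f : sphere R -> R) (M : R) :
  (forall x, `|f x| <= M) -> `|sphere_integral f| <= M * (pi * (2 * pi)).
Proof.
move=> fM; have M0 : 0 <= M := le_trans (normr_ge0 _) (fM pole).
rewrite /sphere_integral; set mu := (_ \x _)%E; set D := _ `*` _.
have pi0 := pi_ge0 R.
have len (r : R) : 0 < r -> lebesgue_measure `[0, r]%classic = r%:E.
  by move=> r0; rewrite lebesgue_measure_itv/= lte_fin r0 sube0.
have muD : (mu D = (pi * (2 * pi))%:E)%E.
  rewrite /mu /D product_measure1E; [|exact: measurable_itv|exact: measurable_itv].
  by rewrite EFinM; congr (_ * _)%E; apply: len; rewrite ?mulr_gt0// pi_gt0.
have muDy : (mu D < +oo)%E by rewrite muD ltry.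
have -> : pi * (2 * pi) = fine (mu D) by rewrite muD.
apply: normr_Rintegral_le => //.
- exact: measurableX.
- by move=> z _; rewrite normrM -[leRHS]mulr1 ler_pM// sin_max.
Qed.

Lemma normr_dot_mulmx_le (R : realType) (u v : 'rV[R]_3) (A : 'M[R]_3) (p q c : R) :
  (forall i, `|u 0 i| <= p) -> (forall i, `|v 0 i| <= q) ->
  (forall i j, `|A i j| <= c) -> `|dot (u *m A) v| <= 9 * (p * c * q).
Proof.
move=> up vq Ac; rewrite /dot.
have sum3 (F : 'I_3 -> R) (s : R) : (forall i, `|F i| <= s) -> `|\sum_i F i| <= 3 * s.
  move=> Fs; apply: le_trans (ler_norm_sum _ _ _) _.
  apply: le_trans (ler_sum _ (fun i _ => Fs i)) _.
  by rewrite sumr_const card_ord mulr_natl.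
have -> : 9 * (p * c * q) = 3 * (3 * (p * c) * q) by ring.
apply: (sum3) => j; rewrite normrM ler_pM// mxE; apply: sum3 => i.
by rewrite normrM ler_pM.
Qed.

Theorem proposition6p5 (R : realType) (m : nat) (hm : (2 <= m)%N)
    (rho : R) (hrho : 1 <= rho)
    (nu : R) (hnu : 0 < nu) (hdecay : lagrange_decay m rho nu)
    (a : sphere R -> 'M[R]_3) (ha : elliptic_tensor a)
    (b : sphere R -> R) (hb : elliptic_potential b) :
  exists h0 C : R, [/\ 0 < h0, 0 < C &
    forall X : {fset sphere R}, admissible h0 rho X ->
    forall chi : sphere R -> sphere R -> R,
      (forall xi, xi \in X -> is_lagrange m X xi (chi xi)) ->
    forall xi eta : sphere R, xi \in X -> eta \in X ->
      `|inner_a a b (chi xi) (chi eta)| <=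
        C * mesh_norm X ^- 2 * expR (- (nu / mesh_norm X) * gdist xi eta)].
Proof.
case: hdecay => hstar [C [hstar0 C0 decay]].
have [ca ca0 a_le] := elliptic_entry_le a ha.
have [_ [b1 [b2 [b10 b12]]]] := hb.
have b20 : 0 < b2.
  by have /andP[lo up] := b12 pole; exact: lt_le_trans b10 (le_trans lo up).
(* Here 36 is 9 terms of the bilinear form times a factor 2 from each gradient; the second summand
   comes from the potential. *)
pose K := 36 * ca * (C * rho) ^+ 2 + b2 * C ^+ 2.
have K0 : 0 < K.
  have rho0 : 0 < rho by lra.
  by rewrite addr_gt0// !mulr_gt0// exprn_gt0// mulr_gt0.
(* Requiring [h <= 1] gives [1 <= h^-2], which absorbs the potential term. *)
exists (Num.min hstar 1), (K * (pi * (2 * pi))); split.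
- by rewrite lt_min hstar0 ltr01.
- by rewrite !mulr_gt0 ?pi_gt0.
move=> X [X1]; rewrite le_min => /andP[Xhstar h1] Xrho chi lag xi eta xiX etaX.
have admX : admissible hstar rho X by split.
have q0 := sep_radius_gt0 X X1.
have h0 : 0 < mesh_norm X.
  by apply: mesh_norm_gt0; rewrite -cardfs_gt0 ltnW.
set h := mesh_norm X in h0 h1 *; set q := sep_radius X in q0.
have qh : q^-1 <= rho / h.
  by rewrite ler_pdivlMr// mulrC.
pose E z x := expR (- nu * gdist x z / h).
have E0 z x : 0 < E z x := expR_gt0 _.
have chi_le z x : z \in X -> `|chi z x| <= C * E z x.
  by move=> zX; exact: (decay X admX z (chi z) zX (lag z zX)).1.
have grad_le z x i : z \in X -> `|sgrad (chi z) x 0 i| <= 2 * (C * rho / h * E z x).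
  (* The exponential is centred at the point [x] where the gradient is taken, so it is constant in
     [y] and can be part of [L]. *)
  move=> zX; apply: (normr_sgrad_le (chi z) x q) => // [|y yq].
    rewrite mulr_ge0 ?(ltW (E0 _ _))// divr_ge0 ?(ltW h0)// mulr_ge0 ?(ltW C0)//; lra.
  have [_ lip] := decay X admX z (chi z) zX (lag z zX).
  apply: le_trans (lip x y yq) _.
  have -> : C * (gdist x y / sep_radius X) * expR (- nu * gdist x z / mesh_norm X) =
      C * gdist x y * E z x * q^-1 by rewrite /E -/h -/q; ring.
  have -> : C * rho / h * E z x * gdist x y = C * gdist x y * E z x * (rho / h).
    by ring.
  by rewrite ler_wpM2l// !mulr_ge0 ?gdist_ge0 ?(ltW C0) ?(ltW (E0 _ _)).
have EE x : E xi x * E eta x <= expR (- (nu / h) * gdist xi eta).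
  rewrite /E -expRD ler_expR.
  have -> : - nu * gdist x xi / h + - nu * gdist x eta / h =
      - (nu / h) * (gdist xi x + gdist x eta) by rewrite (gdistC x xi); ring.
  by rewrite !mulNr lerN2 ler_wpM2l ?gdist_triangle// divr_ge0// ltW.
set e := expR _ in EE *.
have -> : K * (pi * (2 * pi)) * h ^- 2 * e = K * h ^- 2 * e * (pi * (2 * pi)).
  by ring.
apply: normr_sphere_integral_le => x.
apply: le_trans (_ : K * h ^- 2 * (E xi x * E eta x) <= _); last first.
  by rewrite ler_wpM2l// mulr_ge0 ?(ltW K0)// invr_ge0 exprn_ge0// ltW.
apply: le_trans (ler_normD _ _) _.
have dot_le := normr_dot_mulmx_le _ _ _ _ _ _ _
  (fun i => grad_le xi x i xiX) (fun i => grad_le eta x i etaX) (a_le x).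
have b_le : `|b x * chi xi x * chi eta x| <= b2 * C ^+ 2 * h ^- 2 * (E xi x * E eta x).
  apply: le_trans (_ : b2 * (C * E xi x) * (C * E eta x) <= _).
    rewrite !normrM !ler_pM ?mulr_ge0 ?chi_le//.
    by have /andP[lo up] := b12 x; rewrite ger0_norm// (le_trans _ lo)// ltW.
  have -> : b2 * (C * E xi x) * (C * E eta x) = b2 * C ^+ 2 * (E xi x * E eta x) * 1.
    by ring.
  (* The trailing factor 1 is compared with [h^-2]. *)
  rewrite [leRHS]mulrAC ler_wpM2l ?mulr_ge0 ?exprn_ge0 ?(ltW (E0 _ _)) ?(ltW b20) ?(ltW C0)//.
  by rewrite invf_ge1 ?exprn_gt0// expr_le1// (ltW h0).
(* By the choice of [K], the two bounds add up exactly to the target. *)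
apply: le_trans (lerD dot_le b_le) _; rewrite /K le_eqVlt; apply/orP; left.
by apply/eqP; field; rewrite gt_eqF.
Qed.
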